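(* Let $q=p^n$ with $p$ a prime number and $n\ge 1$. For $d\ge 1$ let $N_2(d)$ be the number of polynomials in $\mathbb{F}_q[x,y]$ of (total) degree exactly $d$, and let $I_2(d)$ be the number of irreducible polynomials in $\mathbb{F}_q[x,y]$ of degree exactly $d$. Then, as $d\to+\infty$ (with $q$ fixed), $$1-\frac{I_2(d)}{N_2(d)} \sim \frac{q+1}{q^{d}}.$$
   Context: $\mathbb{F}_q$ denotes the finite field with $q$ elements. Degree means total degree. The notation $u(d)\sim v(d)$ means $u(d)/v(d)\to 1$ as $d\to+\infty$. *)

(* Defs.v *)
From HB Require Import structures.
From mathcomp Require Import all_boot all_order all_algebra finmap.
From mathcomp Require Import boolp classical_sets functions cardinality.
From mathcomp Require Import reals topology normedtype sequences.
(* The notations of mpoly clash with those of topology. *)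
From mathcomp Require Import -(notations) mpoly.

Set Implicit Arguments.
Unset Strict Implicit.
Unset Printing Implicit Defensive.

Import Order.TTheory GRing.Theory Num.Theory numFieldNormedType.Exports.

Local Open Scope ring_scope.
Local Open Scope classical_set_scope.

Local Notation "{ 'mpoly' T [ n ] }" := (mpoly.mpoly n T).

Definition irreducible (A : idomainType) (p : A) : Prop :=
  [/\ p != 0, p \isn't a GRing.unit &
      forall a b : A, p = a * b -> a \is a GRing.unit \/ b \is a GRing.unit].

(* [msize] is one more than the total degree, and 0 on the zero polynomial,
   which therefore has no degree. *)
Definition polys2 (F : finFieldType) (d : nat) : set {mpoly F[2]} :=
  [set p | msize p = d.+1].
Arguments polys2 : clear implicits.

Definition irr_polys2 (F : finFieldType) (d : nat) : set {mpoly F[2]} :=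
  [set p | polys2 F d p /\ irreducible p].
Arguments irr_polys2 : clear implicits.

(* [fset_set] sends an infinite set to the empty one; [finite_polys2] below
   shows that this does not occur here. *)
Definition N2 (F : finFieldType) (d : nat) : nat :=
  #|` fset_set (polys2 F d)|%fset.

Definition I2 (F : finFieldType) (d : nat) : nat :=
  #|` fset_set (irr_polys2 F d)|%fset.

Definition asymp_equiv (R : realType) (u v : R^nat) : Prop :=
  u d / v d @[d --> \oo] --> (1 : R).

Lemma finite_polys2 (F : finFieldType) (d : nat) : finite_set (polys2 F d).
Proof.
pose g (c : {ffun bmultinom 2 d.+1 -> F}) : {mpoly F[2]} :=
  \sum_m c m *: mpolyX F (bmnm m).
apply: (@sub_finite_set _ _ (g @` setT)); last exact/finite_image/finite_finset.
move=> p /= pd; exists [ffun m => mcoeff (bmnm m) p]; first by [].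
rewrite [RHS](@mpolywE _ _ d.+1) ?pd // /g.
by apply: eq_bigr => m _; rewrite ffunE.
Qed.

Lemma finite_irr_polys2 (F : finFieldType) (d : nat) :
  finite_set (irr_polys2 F d).
Proof. by apply: sub_finite_set (finite_polys2 F d) => p []. Qed.

(* Main.v *)
Require Import Defs.
From mathcomp Require Import finmap ring lra zify.
From mathcomp Require Import -(notations) mpoly.
From mathcomp Require Import all_boot all_order all_algebra.
From mathcomp Require Import boolp functions cardinality.
From mathcomp Require Import classical_sets reals topology normedtype sequences.
Import Order.TTheory GRing.Theory Num.Theory numFieldNormedType.Exports.
Local Open Scope ring_scope.

(** A reducible polynomial of degree d is a product of factors of degrees i and
    d - i with 1 <= i <= d - i. Up to scaling there are q(q+1) affine forms, so the
    factorisations with i = 1 give at most q(q+1) N(d-1) polynomials, and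
    q N(d-1) / N(d) ~ q^(-d). Those with i >= 2 contribute O(d q^(6-2d)) N(d).
    Conversely the products of a normalised affine form and an irreducible
    polynomial of degree d - 1 >= 2 are pairwise distinct, because affine forms are
    prime; this gives at least q(q+1) I(d-1) reducible polynomials, and
    I(d-1) / N(d-1) tends to 1 by the upper bound. *)

Local Notation mpoly2 F := (mpoly.mpoly 2 F).
Local Notation msize := (mmeasure mdeg).

(** * Counting bivariate polynomials by their coefficients *)

Lemma card_bmultinom2S (k : nat) :
  #|{: bmultinom 2 k.+1}| = (#|{: bmultinom 2 k}| + k.+1)%N.
Proof.
(* Fibre the monomials over their degree: the fibre over [d] is the monomial basis of degree [d],
   with [d + 1] elements. *)
have cardE j : #|{: bmultinom 2 j}| = (\sum_(d < j) d.+1)%N.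
  rewrite -sum1_card.
  rewrite (partition_big (fun m : bmultinom 2 j => Ordinal (bmdeg m)) xpredT) //=.
  apply: eq_bigr => d _; rewrite sum1_card.
  have /perm_size : perm_eq
      [seq bmnm m | m <- enum [pred m : bmultinom 2 j | Ordinal (bmdeg m) == d]]
      [seq s2m t | t : d.-tuple 'I_2 <- enum (mpoly.basis 2 d)].
    apply: uniq_perm; first by rewrite map_inj_uniq ?enum_uniq //; exact: val_inj.
      exact: uniq_basis.
    move=> m; rewrite -basis_cover; apply/mapP/eqP => [[m']|md].
      by rewrite mem_enum inE => /eqP <- ->.
    have mj : (mdeg m < j)%N by rewrite md.
    exists (BMultinom mj); last by [].
    by rewrite mem_enum inE; apply/eqP/val_inj.
  by rewrite size_map -cardE mpoly.size_basis addn1 binSn => ->.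
by rewrite !cardE big_ord_recr.
Qed.

Section Count.
Context (F : finFieldType).
Implicit Types (p : mpoly2 F) (d k : nat).
Local Open Scope classical_set_scope.

Definition polys2_le k : set (mpoly2 F) := [set p | (msize p <= k)%N]%classic.

(** A polynomial is its coefficient vector; this single parametrisation yields both finiteness and
    the count. *)
Lemma polys2_leE k : exists2 g : {ffun bmultinom 2 k -> F} -> mpoly2 F,
  injective g & polys2_le k = (g @` setT)%classic.
Proof.
pose g (c : {ffun bmultinom 2 k -> F}) : mpoly2 F :=
  \sum_m c m *: mpolyX F (bmnm m).
have coef c (m : bmultinom 2 k) : mcoeff (bmnm m) (g c) = c m.
  rewrite /g raddf_sum (bigD1 m) //= mcoeffZ mcoeffX eqxx mulr1.
  rewrite big1 ?addr0 // => m' /negPf nm.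
  by rewrite mcoeffZ mcoeffX -bmeqP nm mulr0.
exists g; first by move=> c c' e; apply/ffunP => m; rewrite -!coef e.
apply/seteqP; split => [p /= pk|_ [c _ <-]] /=.
  exists [ffun m : bmultinom 2 k => mcoeff (bmnm m) p]; first by [].
  by rewrite [RHS](mpolywE pk) /g; apply: eq_bigr => m _; rewrite ffunE.
apply: (leq_trans (msize_sum _ _ _)).
apply/bigmax_leqP => m _; apply: (leq_trans (msizeZ_le _ _)).
by rewrite msizeX bmdeg.
Qed.

Lemma finite_polys2_le k : finite_set (polys2_le k).
Proof.
by have [g _ ->] := polys2_leE k; apply/finite_image/finite_finset.
Qed.

Lemma card_polys2_le k :
  #|` fset_set (polys2_le k)|%fset = (#|F| ^ #|{: bmultinom 2 k}|)%N.
Proof.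
have [g ginj ->] := polys2_leE k.
rewrite fset_set_image; last exact: finite_finset.
rewrite card_imfset //= -card_ffun cardE; apply/perm_size/uniq_perm.
- exact: fset_uniq.
- exact: enum_uniq.
move=> c; rewrite mem_enum in_fset_set; last exact: finite_finset.
by apply/idP; rewrite in_setT.
Qed.

(** Remove the polynomials of size at most [d] from those of size at most [d + 1]; the latter have
    [d + 1] more free coefficients. *)
Lemma N2E d :
  N2 F d = (#|F| ^ #|{: bmultinom 2 d}| * (#|F| ^ d.+1 - 1))%N.
Proof.
have sub : polys2_le d `<=` polys2_le d.+1 by move=> p /= /leqW.
have -> : N2 F d = #|` fset_set (polys2_le d.+1 `\` polys2_le d)|%fset.
  rewrite /N2; congr #|` fset_set _|%fset; apply/seteqP; split => p /=.
    by rewrite /polys2_le /= => ->; rewrite ltnn.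
  by rewrite /polys2_le /= => -[p1 p2]; apply/eqP; rewrite eqn_leq p1 ltnNge; apply/negP.
rewrite fset_setD; try exact: finite_polys2_le.
rewrite cardfsDS; last by rewrite -fset_set_sub //; exact: finite_polys2_le.
by rewrite !card_polys2_le card_bmultinom2S expnD mulnBr muln1.
Qed.

Lemma in_fset_polys2 d p : (p \in fset_set (polys2 F d)) = (msize p == d.+1).
Proof.
rewrite in_fset_set; last exact: finite_polys2.
by apply/idP/eqP; rewrite inE.
Qed.

End Count.

(** * Affine forms: normalisation and primality *)

Section LinearFactors.
Context (F : finFieldType).
Implicit Types (p g h : mpoly2 F) (t : F * F + F).

Local Notation X0 := (mpolyX F (mnm1 (0 : 'I_2))).
Local Notation X1 := (mpolyX F (mnm1 (1 : 'I_2))).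
Local Notation cst c := (mpolyC 2 (c : F)).
Local Notation cf0 p := (mcoeff mnm0 p).
Local Notation cfX i p := (mcoeff (mnm1 (i : 'I_2)) p).

(* Representatives of the affine forms up to scaling. *)
Definition lin t : mpoly2 F :=
  match t with
  | inl bc => X0 + bc.1 *: X1 + cst bc.2
  | inr c => X1 + cst c
  end.

Lemma mcoeff_affine (a b c : F) :
  let p := a *: X0 + b *: X1 + cst c in
  [/\ cfX 0 p = a, cfX 1 p = b & cf0 p = c].
Proof.
have U0 (i : 'I_2) : (mnm1 i == mnm0) = false by rewrite -mdeg_eq0 mdeg1.
split; rewrite !mcoeffD !mcoeffZ mcoeffC ?mcoeffXU ?mcoeffX ?U0 ?eqxx /=.
- by rewrite mulr1 !mulr0 !addr0.
- by rewrite mulr1 !mulr0 add0r addr0.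
- by rewrite mulr1 !mulr0 !add0r.
Qed.

Lemma msize_affine_le (a b c : F) :
  (msize (a *: X0 + b *: X1 + cst c) <= 2)%N.
Proof.
apply: (leq_trans (msizeD_le _ _)); rewrite geq_max; apply/andP; split.
  apply: (leq_trans (msizeD_le _ _)).
  by rewrite geq_max !(leq_trans (msizeZ_le _ _)) ?msizeX ?mdeg1.
by rewrite msizeC; case: (c != 0).
Qed.

Lemma affineE p : (msize p <= 2)%N ->
  p = cfX 0 p *: X0 + cfX 1 p *: X1 + cst (cf0 p).
Proof.
move=> p2; have [] := mcoeff_affine (cfX 0 p) (cfX 1 p) (cf0 p).
have := msize_affine_le (cfX 0 p) (cfX 1 p) (cf0 p).
set q := (X in (msize X <= 2)%N) => q2 q0 q1 qc.
apply/mpolyP => m; case dm: (mdeg m) => [|[|k]].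
- by have /eqP -> : m == mnm0; [rewrite -mdeg_eq0 dm | rewrite qc].
- have [i /eqP ->] := mdeg1P _ (introT eqP dm).
  have [->|->] : i = 0 \/ i = 1.
    by case: i => -[|[|//]] lti; [left | right]; apply/val_inj.
  - by rewrite q0.
  - by rewrite q1.
have m2 : (2 <= mdeg m)%N by rewrite dm.
have out r : (msize r <= 2)%N -> mcoeff m r = 0.
  by move=> r2; apply/memN_msupp_eq0/msize_mdeg_ge/(leq_trans r2).
by rewrite !out.
Qed.

Lemma linE t : lin t =
  (if t is inl _ then 1 else 0) *: X0
  + (if t is inl bc then bc.1 else 1) *: X1
  + cst (match t with inl bc => bc.2 | inr c => c end).
Proof. by case: t => [bc|c] /=; rewrite ?scale1r ?scale0r ?add0r. Qed.

(** Forms of the same kind share a coefficient equal to 1, which forces [k = 1]; forms of different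
    kinds give [1 = 0] in the coefficient of [X0] or [X1]. *)
Lemma lin_scale_inj t t' (k : F) : lin t' = k *: lin t -> t = t'.
Proof.
rewrite !linE !scalerDr !scalerA -[k *: cst _]mul_mpolyC -mpolyCM.
set p := LHS; set q := RHS => e.
have := mcoeff_affine (if t' is inl _ then 1 else 0)
  (if t' is inl bc then bc.1 else 1) (match t' with inl bc => bc.2 | inr c => c end).
have := mcoeff_affine (k * (if t is inl _ then 1 else 0))
  (k * (if t is inl bc then bc.1 else 1))
  (k * (match t with inl bc => bc.2 | inr c => c end)).
rewrite /= -/p -/q e => -[-> -> ->] [].
case: t {p q e} => [[b c]|c]; case: t' => [[b' c']|c'] /=;
  rewrite ?mulr0 ?mulr1.
- by move=> ->; rewrite !mul1r => -> ->.
- by move=> ->; rewrite mul0r => /esym/eqP; rewrite oner_eq0.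
- by move=> /esym/eqP; rewrite oner_eq0.
- by move=> _ ->; rewrite mul1r => ->.
Qed.

Lemma msize_lin t : msize (lin t) = 2%N.
Proof.
apply/eqP; rewrite eqn_leq {1}linE msize_affine_le /= ltnNge; apply/negP.
move=> /msize1_polyC e.
have := mcoeff_affine (if t is inl _ then 1 else 0)
  (if t is inl bc then bc.1 else 1) (match t with inl bc => bc.2 | inr c => c end).
rewrite /= -linE e.
have U0 (i : 'I_2) : (mnm1 i == mnm0) = false by rewrite -mdeg_eq0 mdeg1.
rewrite !mcoeffC !U0 !mulr0 => -[h0 h1 _].
by case: t h0 h1 {e} => [bc|c] h0 h1; move/esym/eqP: (h0) (h1);
  rewrite ?oner_eq0 // => _ /esym/eqP; rewrite oner_eq0.
Qed.

Lemma lin_neq0 t : lin t != 0.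
Proof. by rewrite -msize_poly_eq0 msize_lin. Qed.

(** Scale by the coefficient of [X0] if it is nonzero, else by that of [X1]; both cannot vanish,
    since a constant has size at most 1. *)
Lemma msize2_lin p : msize p = 2%N -> exists t c, c != 0 /\ p = c *: lin t.
Proof.
move=> p2; have e := affineE p (eq_leq p2).
have [a0|a0] := eqVneq (cfX 0 p) 0; last first.
  exists (inl (cfX 1 p / cfX 0 p, cf0 p / cfX 0 p)), (cfX 0 p); split=> //.
  rewrite [LHS]e /= !scalerDr scalerA -[in RHS]mul_mpolyC -[_ *: cst _]mul_mpolyC.
  by rewrite -mpolyCM ![_ * (_ / _)]mulrC !divfK // mul_mpolyC.
have [b0|b0] := eqVneq (cfX 1 p) 0.
  move: p2; rewrite e a0 b0 !scale0r !add0r msizeC; by case: eqP.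
exists (inr (cf0 p / cfX 1 p)), (cfX 1 p); split=> //.
rewrite [LHS]e a0 scale0r add0r /= scalerDr -[_ *: cst _]mul_mpolyC.
by rewrite -mpolyCM [_ * (_ / _)]mulrC divfK.
Qed.

(** This is primality of [lin t]: restriction to its zero line takes values in a domain, so it kills
    [lin t'] or [g']. By degree, a normalised form divisible by [lin t] equals it. *)
Lemma lin_euclid t t' g g' : lin t * g = lin t' * g' ->
  t = t' \/ exists h, g' = lin t * h.
Proof.
(* Solve [lin t = 0] for [X0] in the first case and for [X1] in the second. *)
pose sub : 2.-tuple (mpoly2 F) :=
  if t is inl bc then [tuple - (bc.1 *: X1 + cst bc.2); X1]
  else [tuple X0; - cst (if t is inr c then c else 0)].
(* [phi] restricts to the line [lin t = 0]; its kernel is the ideal of [lin t]. *)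
pose phi := comp_mpoly sub.
have phiX i : phi (mpolyX F (mnm1 i)) = sub`_i by exact: comp_mpolyXU.
have phit : phi (lin t) = 0.
  rewrite /phi /lin /sub; case: t {sub phi phiX} => [[b c]|c] /=;
    rewrite !comp_mpolyD ?comp_mpolyZ !comp_mpolyXU comp_mpolyC /=.
    by rewrite -addrA addNr.
  by rewrite addNr.
(* Congruence of [p] and [phi p] modulo [lin t] passes from the variables to monomials by products,
   then to all polynomials by linearity; so [phi p = 0] makes [lin t] divide [p]. *)
pose D p := exists h, p = phi p + lin t * h.
have D1 : D 1 by exists 0; rewrite /phi rmorph1 mulr0 addr0.
have phiM p q : phi (p * q) = phi p * phi q by rewrite /phi rmorphM.
have DM p q : D p -> D q -> D (p * q).
  move=> [h eh] [k ek]; exists (h * phi q + phi p * k + lin t * h * k).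
  by rewrite phiM {1}eh {1}ek; ring.
have DX i : D (mpolyX F (mnm1 i)).
  rewrite /D phiX /sub; case: t {sub phi phiX phit phiM D D1 DM} => [[b c]|c];
  have [->|->] : i = 0 \/ i = 1
    by case: i => -[|[|//]] lti; [left | right]; apply/val_inj.
  - by exists 1; rewrite mulr1 /=; ring.
  - by exists 0; rewrite mulr0 addr0.
  - by exists 0; rewrite mulr0 addr0.
  - by exists 1; rewrite mulr1 /=; ring.
have modlin p : D p.
  elim/mpolyind: p => [|c m p _ _ [h IH]].
    by exists 0; rewrite /phi raddf0 mulr0 addr0.
  have [k ek] : D (mpolyX F m).
    rewrite mpolyXE_id; apply: big_ind => // i _.
    by elim: (m i) => [|r IHr]; [rewrite expr0 | rewrite exprS; apply: DM].
  exists (c *: k + h); rewrite /phi raddfD /= linearZ /= -/phi {1}ek {1}IH.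
  by rewrite -!mul_mpolyC; ring.
move=> e.
have /eqP : phi (lin t') * phi g' = 0.
  by rewrite -phiM -e phiM phit mul0r.
rewrite mulf_eq0 => /orP[/eqP p0|/eqP p0].
  left; have [h eh] := modlin (lin t').
  move: eh; rewrite p0 add0r => eh.
  have h0 : h != 0 by apply: contraTneq (lin_neq0 t') => h0; rewrite eh h0 mulr0 eqxx.
  (* Sizes give [2 = 2 + msize h - 1], so [h] is a nonzero constant. *)
  have := congr1 (fun p => msize p) eh; rewrite msizeM ?lin_neq0 // !msize_lin.
  rewrite addSn /= add1n => -[/esym/eqP/msize_poly1P[k _ hk]].
  by apply: (@lin_scale_inj _ _ k); rewrite eh hk mulrC mul_mpolyC.
by right; have [h eh] := modlin g'; exists h; rewrite eh p0 add0r.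
Qed.

(** * Factorisations and the number of reducible polynomials *)

Local Open Scope classical_set_scope.

(* [msizeM] with the instances found from [F], so that [lia] sees one atom. *)
Lemma msizeM2 p g : p != 0 -> g != 0 -> msize (p * g) = (msize p + msize g).-1.
Proof. exact: msizeM. Qed.

Lemma msize2_eq0 p : (msize p == 0%N) = (p == 0).
Proof. exact: msize_poly_eq0. Qed.

Lemma mpoly_unitE p : (p \is a GRing.unit) = (msize p == 1%N).
Proof.
apply/idP/msize_poly1P => [up|[c c0 ->]].
  have p0 : p != 0 by apply: contraTneq up => ->; rewrite unitr0.
  have /andP[/eqP e _] := up.
  by exists (mcoeff mnm0 p) => //; apply: contra_neq p0 => z; rewrite e z.
by apply/unitrP; exists (mpolyC 2 c^-1); rewrite -!mpolyCM mulVf ?divff.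
Qed.

(** In degree 0 this counts the units; in positive degree, the reducible polynomials. *)
Definition red2 d : nat :=
  #|` fset_set (polys2 F d `\` irr_polys2 F d)|%fset.

Lemma I2_red2 d : (I2 F d + red2 d)%N = N2 F d.
Proof.
have sub : irr_polys2 F d `<=` polys2 F d by move=> p [].
rewrite /red2 fset_setD; [|exact: finite_polys2|exact: finite_irr_polys2].
rewrite cardfsDS -?fset_set_sub ?subnKC //;
  try exact: finite_polys2; try exact: finite_irr_polys2.
apply: fsubset_leq_card; rewrite -fset_set_sub //;
  by [exact: finite_polys2 | exact: finite_irr_polys2].
Qed.

Lemma finite_red2 d : finite_set (polys2 F d `\` irr_polys2 F d).
Proof. by apply: sub_finite_set (finite_polys2 F d) => p []. Qed.

Lemma card_affine_forms : #|{: F * F + F}| = (#|F| * (#|F| + 1))%N.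
Proof. by rewrite card_sum card_prod mulnDr muln1. Qed.

(** In positive degree [p] is neither zero nor a unit, so irreducibility can only fail through two
    nonunit factors. Sizes exceed degrees by one, whence the sum [d + 3]. *)
Lemma polys2_red_factor d p : polys2 F d.+1 p -> ~ irr_polys2 F d.+1 p ->
  exists a b, [/\ p = a * b, (2 <= msize a <= msize b)%N
    & (msize a + msize b = d.+3)%N].
Proof.
move=> pd nirr.
have p0 : p != 0 by rewrite -msize2_eq0 pd.
have nup : p \isn't a GRing.unit by rewrite mpoly_unitE pd.
have [a [b [e na nb]]] : exists a b,
    [/\ p = a * b, a \isn't a GRing.unit & b \isn't a GRing.unit].
  apply: contrapT => h; apply: nirr; split=> //; split=> // a b e.
  have [ua|na] := boolP (a \is a GRing.unit); first by left.
  have [ub|nb] := boolP (b \is a GRing.unit); first by right.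
  by case: h; exists a, b.
have : a * b != 0 by rewrite -e.
rewrite mulf_eq0 negb_or => /andP[a0 b0].
have sab : (msize a + msize b = d.+3)%N.
  by have := pd; rewrite /polys2 /= e msizeM2 //; lia.
move: na nb a0 b0; rewrite !mpoly_unitE -!msize2_eq0 => na nb a0 b0.
have [ab|ba] := leqP (msize a) (msize b).
  by exists a, b; split=> //; lia.
by exists b, a; split; [rewrite mulrC | lia | lia].
Qed.

(** The list [s] of products contains every reducible polynomial, possibly repeatedly, so its length
    bounds their number. *)
Lemma red2_le d : (red2 d.+1 <=
  #|F| * (#|F| + 1) * N2 F d + \sum_(2 <= i < d) N2 F i * N2 F (d.+1 - i))%N.
Proof.
pose P i := enum_fset (fset_set (polys2 F i)).
have memP i p : (p \in P i) = (msize p == i.+1) by exact: in_fset_polys2.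
pose s := [seq lin t * g | t <- enum {: F * F + F}, g <- P d] ++
  flatten [seq [seq a * b | a <- P i, b <- P (d.+1 - i)%N] | i <- index_iota 2 d].
have -> : (#|F| * (#|F| + 1) * N2 F d
   + \sum_(2 <= i < d) N2 F i * N2 F (d.+1 - i))%N = size s.
  rewrite size_cat size_allpairs -cardE card_affine_forms size_flatten /shape.
  rewrite sumnE !big_map; congr (_ + _)%N.
  by apply: eq_bigr => i _; rewrite size_allpairs.
apply: uniq_leq_size; first exact: fset_uniq.
move=> p; rewrite in_fset_set; last exact: finite_red2.
rewrite inE => -[pd nirr].
have [a [b [e /andP[a2 ab] sab]]] := polys2_red_factor _ _ pd nirr.
rewrite mem_cat; apply/orP.
have [sa|sa] := eqVneq (msize a) 2%N.
  have [t [c [c0 ea]]] := msize2_lin _ sa.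
  (* The scalar [c] moves to the cofactor, so only normalised forms are listed. *)
  left; apply/allpairsP; exists (t, c *: b); split; first by rewrite mem_enum.
    have sb : msize b = d.+1 by lia.
    by rewrite memP msizeZ //; exact/eqP.
  by rewrite e ea /= -scalerAl scalerAr.
(* Both factors now have degree at least 2, which keeps the index [(msize a).-1] below [d]. *)
right; apply/flattenP.
exists [seq x * y | x <- P (msize a).-1, y <- P (d.+1 - (msize a).-1)%N].
  by apply/mapP; exists (msize a).-1; rewrite // mem_index_iota; lia.
apply/allpairsP; exists (a, b); split; rewrite //= memP; apply/eqP; lia.
Qed.

(** If two products agree but their forms differ, [lin_euclid] makes an affine form divide an
    irreducible cofactor; the quotient is a unit, so the cofactor has degree 1, against [2 <= d]. *)
Lemma red2_ge d : (2 <= d)%N ->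
  (#|F| * (#|F| + 1) * I2 F d <= red2 d.+1)%N.
Proof.
move=> d2; pose Q := enum_fset (fset_set (irr_polys2 F d)).
have memQ p : p \in Q -> irr_polys2 F d p.
  by rewrite in_fset_set ?inE //; exact: finite_irr_polys2.
have -> : (#|F| * (#|F| + 1) * I2 F d)%N =
    size [seq lin t * g | t <- enum {: F * F + F}, g <- Q].
  by rewrite size_allpairs -cardE card_affine_forms.
apply: uniq_leq_size.
  apply: allpairs_uniq; [exact: enum_uniq | exact: fset_uniq |].
  move=> [t g] [t' g'] /allpairsP[[t1 g1] [_ /memQ gQ [-> ->]]].
  move=> /allpairsP[[t2 g2] [_ /memQ gQ' [-> ->]]] /= {t g t' g'} e.
  have [tt|[h eh]] := lin_euclid _ _ _ _ e.
    by rewrite -tt in e *; rewrite (mulfI (lin_neq0 t1) e).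
  case: gQ' => sg [g0 _ /(_ _ _ eh)]; rewrite !mpoly_unitE msize_lin => -[//|/eqP sh].
  have h0 : h != 0 by rewrite -msize2_eq0 sh.
  by move: sg; rewrite /polys2 /= eh msizeM2 ?lin_neq0 // msize_lin sh => -[]; lia.
move=> p /allpairsP[[t g] [_ /memQ [/= sg [g0 gu _]] ->]].
rewrite in_fset_set; last exact: finite_red2.
rewrite inE; split; first by rewrite /polys2 /= msizeM2 ?lin_neq0 // msize_lin sg.
move=> -[_ [_ _ /(_ _ _ erefl)]]; rewrite !mpoly_unitE msize_lin sg.
by case=> // /eqP; lia.
Qed.

End LinearFactors.

(** * Size estimates and the limit *)

Section Asymptotics.
Context (R : realType) (F : finFieldType).
Implicit Types (d i j : nat).
Local Open Scope classical_set_scope.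
Local Notation q := #|F|.
Local Notation Q := (q%:R : R).
Local Notation B d := #|{: bmultinom 2 d}|.

(** A triangular number, doubled to avoid division in [nat]. *)
Lemma card_bmultinom2 d : (2 * B d = d * d.+1)%N.
Proof.
elim: d => [|d IH]; last by rewrite card_bmultinom2S; lia.
by rewrite mul0n (eq_card0 (A := {: bmultinom 2 0})) // => m; have := bmdeg m; rewrite ltn0.
Qed.

Lemma q_gt1 : (1 < q)%N. Proof. exact: card_finNzRing_gt1. Qed.

Lemma N2_le d : (N2 F d <= q ^ B d.+1)%N.
Proof. by rewrite N2E card_bmultinom2S expnD leq_mul2l leq_subr orbT. Qed.

Lemma N2_ge d : (q ^ (B d + d) <= N2 F d)%N.
Proof.
rewrite N2E expnD leq_mul2l expnS; apply/orP; right.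
have : (0 < q ^ d)%N by rewrite expn_gt0 (ltnW q_gt1).
by have := q_gt1; nia.
Qed.

Lemma N2_gt0 d : (0 < N2 F d)%N.
Proof. by apply: leq_trans (N2_ge d); rewrite expn_gt0 (ltnW q_gt1). Qed.

Lemma N2_mul_le i j : (2 <= i)%N -> (2 <= j)%N ->
  (N2 F i * N2 F j * q ^ (2 * (i + j)) <= q ^ 6 * N2 F (i + j))%N.
Proof.
move=> i2 j2.
apply: (@leq_trans (q ^ (6 + (B (i + j) + (i + j))))); last first.
  by rewrite expnD leq_mul2l N2_ge orbT.
apply: (@leq_trans (q ^ (B i.+1 + B j.+1 + 2 * (i + j)))).
  by rewrite 2!expnD leq_mul2r leq_mul ?N2_le ?orbT.
rewrite leq_pexp2l ?(ltnW q_gt1) //.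
(* Twice the difference of the exponents is [2 (i - 2) (j - 2) >= 0]; this is where the constant 6
   comes from. *)
have := card_bmultinom2 i.+1; have := card_bmultinom2 j.+1.
by have := card_bmultinom2 (i + j); nia.
Qed.

Lemma sum_N2_le d :
  ((\sum_(2 <= i < d) N2 F i * N2 F (d.+1 - i)) * q ^ (2 * d.+1)
    <= d.+1 * (q ^ 6 * N2 F d.+1))%N.
Proof.
rewrite big_distrl /= -[X in (_ <= X * _)%N](subn0) -sum_nat_const_nat.
apply: (@leq_trans (\sum_(2 <= i < d) q ^ 6 * N2 F d.+1)%N).
  rewrite big_nat [leqRHS]big_nat; apply: leq_sum => i /andP[i2 id].
  by have := @N2_mul_le i (d.+1 - i) i2; rewrite subnKC; [apply; lia | lia].
by rewrite !sum_nat_const_nat leq_mul2r; apply/orP; right; lia.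
Qed.

(** Since [1 - I2 / N2 = red2 / N2], this is the quotient whose limit the theorem asserts to be
    1. *)
Definition red_ratio d : R := (red2 F d)%:R / (N2 F d)%:R * Q ^+ d / (Q + 1).

Let Q_ge2 : 2 <= Q. Proof. by rewrite (ler_nat _ 2%N) q_gt1. Qed.
Let Q_gt0 : 0 < Q. Proof. by have := Q_ge2; lra. Qed.
Let n_gt0 d : 0 < (N2 F d)%:R :> R. Proof. by rewrite ltr0n N2_gt0. Qed.

(** The exact ratio of consecutive counts, cleared of denominators; [Q * N2 d * Q^(d+1) / N2 (d+1)]
    is what the affine factors contribute to [red_ratio]. *)
Lemma N2_step d : Q * (N2 F d)%:R * Q ^+ d.+1 * (Q ^+ d.+2 - 1)
  = Q * (Q ^+ d.+1 - 1) * (N2 F d.+1)%:R.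
Proof.
rewrite !N2E card_bmultinom2S expnD !natrM !natrB ?expn_gt0 ?(ltnW q_gt1) //.
by rewrite !natrX; ring.
Qed.

Lemma red_ratio_le d : red_ratio d.+1 <= 1 + Q ^+ 6 * (d.+1%:R * Q^-1 ^+ d.+1).
Proof.
have qd : 0 < Q ^+ d.+1 by rewrite exprn_gt0.
have q2d : 1 < Q ^+ d.+2 by rewrite exprn_egt1 //; have := Q_ge2; lra.
rewrite /red_ratio ler_pdivrMr; last by have := Q_gt0; lra.
rewrite mulrAC ler_pdivrMr //.
have h1 : (red2 F d.+1)%:R <= Q * (Q + 1) * (N2 F d)%:R
    + (\sum_(2 <= i < d) N2 F i * N2 F (d.+1 - i))%N%:R :> R.
  by have := red2_le F d; rewrite -(ler_nat R) natrD !natrM natrD.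
have h2 : (\sum_(2 <= i < d) N2 F i * N2 F (d.+1 - i))%N%:R * Q ^+ d.+1
   <= d.+1%:R * Q^-1 ^+ d.+1 * (Q ^+ 6 * (N2 F d.+1)%:R).
  have := sum_N2_le d; rewrite -(ler_nat R) !natrM !natrX mulnC exprM expr2.
  rewrite mulrA => h; rewrite -(ler_pM2r qd); apply: (le_trans h).
  rewrite le_eqVlt; apply/orP; left; apply/eqP.
  rewrite exprVn; field; exact: lt0r_neq0.
(* By [N2_step] this amounts to [Q^(d+2) - Q <= Q^(d+2) - 1]. *)
have h3 : Q * (N2 F d)%:R * Q ^+ d.+1 <= (N2 F d.+1)%:R.
  rewrite -(ler_pM2r (_ : 0 < Q ^+ d.+2 - 1)); last by lra.
  rewrite N2_step mulrC ler_pM2l // [in leRHS]exprS.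
  by have := Q_ge2; lra.
set w := d.+1%:R * _ in h2 *; have w0 : 0 <= w.
  by rewrite /w mulr_ge0 // exprn_ge0 // invr_ge0 ltW.
move: (ler_wpM2r (ltW qd) h1); rewrite mulrDl => h1'.
have h3' : Q * (Q + 1) * (N2 F d)%:R * Q ^+ d.+1 <= (Q + 1) * (N2 F d.+1)%:R.
  have -> : Q * (Q + 1) * (N2 F d)%:R * Q ^+ d.+1
    = (Q + 1) * (Q * (N2 F d)%:R * Q ^+ d.+1) by ring.
  by apply: (ler_wpM2l _ h3); have := Q_gt0; lra.
(* The error term in the goal is [Q + 1] times the bound of [h2]; this is the nonnegative
   surplus. *)
have z0 : 0 <= w * (Q ^+ 6 * (N2 F d.+1)%:R) * Q.
  apply: mulr_ge0 (ltW Q_gt0); apply: mulr_ge0 => //.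
  by apply: mulr_ge0 (ltW (n_gt0 _)); rewrite exprn_ge0 ?ltW.
rewrite (_ : _ * (Q + 1) * _ = (Q + 1) * (N2 F d.+1)%:R
  + (w * (Q ^+ 6 * (N2 F d.+1)%:R) + w * (Q ^+ 6 * (N2 F d.+1)%:R) * Q));
  [lra | ring].
Qed.

(** The second factor is [I2 / N2] in degree [d], written through [red_ratio d] so that the upper
    bound in degree [d] feeds the lower bound in degree [d + 1]. *)
Lemma red_ratio_ge d : (2 <= d)%N -> red_ratio d.+1 >=
  (1 - Q^-1 ^+ d) * (1 - red_ratio d * Q^-1 ^+ d * (Q + 1)).
Proof.
move=> d2; have Q1 : 0 < Q + 1 by have := Q_gt0; lra.
have qd : 0 < Q ^+ d by rewrite exprn_gt0.
have qd1 : 0 < Q ^+ d.+1 by rewrite exprn_gt0.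
have q2d : 1 < Q ^+ d.+2 by rewrite exprn_egt1 //; have := Q_ge2; lra.
have -> : 1 - red_ratio d * Q^-1 ^+ d * (Q + 1) = (I2 F d)%:R / (N2 F d)%:R.
  rewrite /red_ratio -I2_red2 natrD exprVn; field.
  by rewrite -natrD I2_red2 !lt0r_neq0.
have h1 : Q * (Q + 1) * (I2 F d)%:R <= (red2 F d.+1)%:R.
  by have := red2_ge F d d2; rewrite -(ler_nat R) !natrM natrD.
(* After [N2_step] and expansion, this follows from [Q <= Q^2] and [Q^(-d) <= 1]. *)
have h3 : (1 - Q^-1 ^+ d) * (N2 F d.+1)%:R <= Q * (N2 F d)%:R * Q ^+ d.+1.
  rewrite -(ler_pM2r (_ : 0 < Q ^+ d.+2 - 1)); last by lra.
  rewrite N2_step mulrAC; apply: ler_wpM2r => //.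
  have -> : (1 - Q^-1 ^+ d) * (Q ^+ d.+2 - 1) = Q ^+ d.+2 - Q ^+ 2 - 1 + Q^-1 ^+ d.
    by rewrite !exprS exprVn; field; exact: lt0r_neq0.
  have w1 : Q^-1 ^+ d <= 1.
    by rewrite exprn_ile1 ?invr_ge0 ?invf_le1 ?ltW //; have := Q_ge2; lra.
  by rewrite [in leRHS]mulrBr -exprS; have := Q_ge2; nra.
rewrite /red_ratio ler_pdivlMr // [leRHS]mulrAC.
apply: (@le_trans _ _ (Q * (Q + 1) * (I2 F d)%:R * Q ^+ d.+1 / (N2 F d.+1)%:R)); last first.
  by apply: ler_wpM2r; [rewrite invr_ge0 ltW | apply: ler_wpM2r; first exact: ltW].
rewrite ler_pdivlMr //.
have -> : (1 - Q^-1 ^+ d) * ((I2 F d)%:R / (N2 F d)%:R) * (Q + 1) * (N2 F d.+1)%:R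
  = (1 - Q^-1 ^+ d) * (N2 F d.+1)%:R * ((I2 F d)%:R / (N2 F d)%:R * (Q + 1)) by ring.
apply: le_trans (ler_wpM2r _ h3) _; first by rewrite mulr_ge0 ?divr_ge0 // ltW.
by rewrite le_eqVlt; apply/orP; left; apply/eqP; field; exact: lt0r_neq0.
Qed.

(** Induction gives [d <= 2 (3/2)^d], as the right side grows by [(3/2)^d >= 1] at each step; then
    [(3/2) (1/2) = 3/4] is still below 1. *)
Lemma natr_half_expr_le d (w : R) : 0 <= w <= 2^-1 -> d%:R * w ^+ d <= 2 * (3 / 4) ^+ d.
Proof.
move=> /andP[w0 w2].
have h : d%:R <= 2 * (3 / 2) ^+ d :> R.
  elim: d => [|d IH]; first by rewrite expr0; lra.
  have : 1 <= (3 / 2) ^+ d :> R by apply: exprn_ege1; lra.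
  by rewrite exprS -[d.+1%:R]natr1; lra.
apply: (@le_trans _ _ (2 * (3 / 2) ^+ d * 2^-1 ^+ d)).
  by apply: ler_pM => //; rewrite ?exprn_ge0 // lerXn2r // nnegrE; lra.
by rewrite -mulrA -exprMn; apply: ler_wpM2l => //; rewrite le_eqVlt; apply/orP; left; apply/eqP; congr (_ ^+ _); field.
Qed.

Lemma cvg_natr_mul_expr (w : R) : 0 <= w <= 2^-1 ->
  d%:R * w ^+ d @[d --> \oo] --> (0 : R).
Proof.
move=> w2; apply: (@squeeze_cvgr _ _ _ _ (fun=> 0) (fun d => 2 * (3 / 4) ^+ d)).
- apply: nearW => d; rewrite natr_half_expr_le // andbT.
  by rewrite mulr_ge0 // exprn_ge0 //; case/andP: w2.
- exact: cvg_cst.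
rewrite -(mulr0 2); apply: cvgM; first exact: cvg_cst.
by apply: cvg_expr; rewrite ger0_norm; lra.
Qed.

Lemma cvg_red_ratio : red_ratio d @[d --> \oo] --> (1 : R).
Proof.
rewrite -cvg_shiftS.
pose e d : R := Q ^+ 6 * (d%:R * Q^-1 ^+ d).
have w2 : 0 <= Q^-1 <= 2^-1 by rewrite invr_ge0 ltW //= lef_pV2 ?posrE //; have := Q_ge2; lra.
have w0 : Q^-1 ^+ d @[d --> \oo] --> (0 : R).
  by apply: cvg_expr; rewrite ger0_norm; lra.
have e0 : e d @[d --> \oo] --> (0 : R).
  rewrite -(mulr0 (Q ^+ 6)); apply: cvgM; first exact: cvg_cst.
  exact: cvg_natr_mul_expr.
(* The lower bound is that of [red_ratio_ge] with [red_ratio d] replaced by its own upper bound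
   [1 + e d]. *)
apply: (@squeeze_cvgr _ _ _ _
  (fun d => (1 - Q^-1 ^+ d) * (1 - (1 + e d) * Q^-1 ^+ d * (Q + 1)))
  (fun d => 1 + e d.+1)).
- near=> d.
  have d2 : (2 <= d)%N by near: d; exact: nbhs_infty_ge.
  rewrite red_ratio_le andbT; apply: le_trans (red_ratio_ge _ d2).
  have wd0 : 0 <= Q^-1 ^+ d by rewrite exprn_ge0 //; case/andP: w2.
  have wd1 : Q^-1 ^+ d <= 1 by rewrite exprn_ile1 //; lra.
  apply: ler_wpM2l; first by lra.
  rewrite lerD2l lerN2 ler_wpM2r //; first by have := Q_gt0; lra.
  rewrite ler_wpM2r //.
  by case: (d) d2 => [//|k] _; exact: red_ratio_le.
- rewrite [X in _ --> X](_ : 1 = (1 - 0) * (1 - (1 + 0) * 0 * (Q + 1))); last by ring.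
  apply: cvgM; first by apply: cvgB; [exact: cvg_cst | exact: w0].
  apply: cvgB; first exact: cvg_cst.
  apply: cvgM; last exact: cvg_cst.
  apply: cvgM; last exact: w0.
  by apply: cvgD; [exact: cvg_cst | exact: e0].
- rewrite -[X in _ --> X]addr0; apply: cvgD; first exact: cvg_cst.
  by rewrite (cvg_shiftS e).
Unshelve. all: by end_near.
Qed.

End Asymptotics.

Theorem mainTheorem1 (R : realType) (p n : nat) (hp : prime p) (hn : (1 <= n)%N)
    (F : finFieldType) (hF : #|F| = (p ^ n)%N) :
  asymp_equiv
    (fun d : nat => 1 - (I2 F d)%:R / (N2 F d)%:R : R)
    (fun d : nat => ((p ^ n)%N%:R + 1) / (p ^ n)%N%:R ^+ d : R).
Proof.
rewrite /asymp_equiv -hF.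
suff -> : (fun d => (1 - (I2 F d)%:R / (N2 F d)%:R) / ((#|F|%:R + 1) / #|F|%:R ^+ d))
    = red_ratio R F by exact: cvg_red_ratio.
apply/funext => d; rewrite /red_ratio invf_div mulrA; congr (_ * _ / _).
have N0 : (N2 F d)%:R != 0 :> R by rewrite pnatr_eq0 -lt0n N2_gt0.
(* Write 1 as [N2 / N2] and split [N2] as [I2 + red2]. *)
by rewrite -{1}(divff N0) -mulrBl -{1}I2_red2 natrD addrC addKr.
Qed.
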